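(* Let the penalty function $g_{\lambda}(x) = f(x) + \lambda \phi(x)$ be (globally) exact, let $\Phi$ be an approximation of the penalty term $\phi$, and put $F_{\lambda}(x, p) = f(x) + \lambda \Phi(x, p)$. Let a sequence $\{ p_n \} \subset P$ converge to $p_0$, and let a sequence $\{ x_n \} \subset A$ satisfy $$F_{\lambda}(x_n, p_n) \le \inf_{x \in A} F_{\lambda}(x, p_n) + \varepsilon_n \quad \forall n \in \mathbb{N}$$ for some $\lambda > \lambda^*(f, \phi)$ and a decreasing sequence $\{ \varepsilon_n \} \subset (0, + \infty)$ such that $\varepsilon_n \to 0$ as $n \to \infty$. Then $\phi(x_n) \to 0$ as $n \to \infty$, and $\lim_{n \to \infty} f(x_n) = f^*$. If, additionally, $f$ and $\phi$ are l.s.c. on $A$, and the set $A$ is closed, then any cluster point $x^*$ of the sequence $\{ x_n \}$ (if one exists) is a globally optimal solution of the problem $(\mathcal{P})$.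
   Context: Setting. $X$ is a metric space, $M, A \subset X$ are nonempty, $f \colon X \to \mathbb{R} \cup \{+\infty\}$. The problem $(\mathcal{P})$ is: minimize $f(x)$ subject to $x \in M$, $x \in A$. $\Omega = M \cap A$; it is assumed that $f$ attains a global minimum on $\Omega$, with finite value $f^*$. $\phi \colon X \to [0,+\infty]$ satisfies $\phi(x) = 0$ iff $x \in M$. $P$ is a metric space and $p_0 \in P$ is fixed. Exactness of $g_\lambda$: there exists $\lambda_0 \ge 0$ such that $g_{\lambda_0}$ attains a global minimum on $A$ and $x^*$ is a global minimizer of $g_{\lambda_0}$ on $A$ iff $x^*$ is a globally optimal solution of $(\mathcal{P})$; $\lambda^*(f,\phi)$ denotes the infimum of all such $\lambda_0$. Approximation: a function $\Phi \colon X \times P \to [0,+\infty]$ is an approximation of $\phi$ if $\Phi(\cdot, p_0) = \phi(\cdot)$ and $\Phi(\cdot, p) \to \phi(\cdot)$ as $p \to p_0$ uniformly on $A$, i.e. for every $\sigma > 0$ there is a neighbourhood $W$ of $p_0$ such that $\Phi(x,p) \le \phi(x) + \sigma$ and $\phi(x) \le \Phi(x,p) + \sigma$ for all $x \in A$, $p \in W$. ''L.s.c. on a set'' means lower semicontinuous at every point of that set. *)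

(* Defs.v *)
From HB Require Import structures.
From mathcomp Require Import all_boot all_order all_algebra.
From mathcomp Require Import all_classical all_reals all_analysis.

Set Implicit Arguments.
Unset Strict Implicit.
Unset Printing Implicit Defensive.

Import Order.TTheory GRing.Theory Num.Theory.
Import numFieldNormedType.Exports.

Local Open Scope classical_set_scope.
Local Open Scope ring_scope.
Local Open Scope ereal_scope.

Definition global_minimizer (R : realType) (X : Type) (h : X -> \bar R)
  (D : set X) (x : X) : Prop :=
  D x /\ forall y, D y -> h x <= h y.

Definition globally_optimal (R : realType) (X : Type) (f : X -> \bar R)
  (M A : set X) (x : X) : Prop :=
  global_minimizer f (M `&` A) x.

Definition optimal_value (R : realType) (X : Type) (f : X -> \bar R)
  (M A : set X) : \bar R :=
  ereal_inf (f @` (M `&` A)).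

(* The library's convention 0 * +oo = 0 applies, so that [penalty_fun f phi 0]
   is [f]. No sum -oo + +oo occurs when f > -oo, phi >= 0 and l >= 0. *)
Definition penalty_fun (R : realType) (X : Type) (f phi : X -> \bar R) (l : R)
  (x : X) : \bar R :=
  f x + l%:E * phi x.

Definition exact_parameter (R : realType) (X : Type) (f phi : X -> \bar R)
  (M A : set X) (l : R) : Prop :=
  [/\ (0 <= l)%R,
      exists x, global_minimizer (penalty_fun f phi l) A x &
      forall x, global_minimizer (penalty_fun f phi l) A x <->
                globally_optimal f M A x].

Definition exact_penalty (R : realType) (X : Type) (f phi : X -> \bar R)
  (M A : set X) : Prop :=
  exists l, exact_parameter f phi M A l.

(* [inf] is the true infimum only on nonempty sets: this value is meaningful
   under [exact_penalty f phi M A]. *)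
Definition least_exact_parameter (R : realType) (X : Type)
  (f phi : X -> \bar R) (M A : set X) : R :=
  inf [set l | exact_parameter f phi M A l].

Definition penalty_approximation (R : realType) (X : Type) (P : metricType R)
  (A : set X) (phi : X -> \bar R) (p0 : P) (Phi : X -> P -> \bar R) : Prop :=
  [/\ forall x p, 0 <= Phi x p,
      forall x, Phi x p0 = phi x &
      forall sigma : R, (0 < sigma)%R -> \forall p \near p0,
        forall x, A x ->
          Phi x p <= phi x + sigma%:E /\ phi x <= Phi x p + sigma%:E].

(* Pointwise form of the library's [lower_semicontinuous]; neighbourhoods are
   taken in the whole space X, not relatively to A. *)
Definition lsc_on (R : realType) (X : topologicalType) (f : X -> \bar R)
  (A : set X) : Prop :=
  forall x, A x -> forall a : R, a%:E < f x -> \forall y \near x, a%:E < f y.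

(* Main.v *)
(* Pick an exact parameter l < lambda and put k = lambda - l, so that
   f* <= f + l phi on A. Comparing x_n with an optimal solution, where phi = 0,
   gives f(x_n) + lambda phi(x_n) <= f* + d with d arbitrarily small for large
   n; subtracting the two inequalities, k phi(x_n) <= d, so phi(x_n) -> 0 and
   then f(x_n) -> f*. At a cluster point, lower semicontinuity yields phi <= 0
   and f <= f*. *)
Require Import Defs.
From HB Require Import structures.
From mathcomp Require Import all_boot all_order all_algebra.
From mathcomp Require Import all_classical all_reals all_analysis.
From mathcomp Require Import lra.

Import Order.TTheory GRing.Theory Num.Theory.
Import numFieldNormedType.Exports.

Local Open Scope classical_set_scope.
Local Open Scope ring_scope.
Local Open Scope ereal_scope.

(** The bounds for [s = 1] already make [u n] finite for large [n], which reduces the claim to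
    convergence of real numbers. *)
Lemma cvg_EFin_le_dist (R : realType) (u : nat -> \bar R) (a : R) :
  (forall s : R, (0 < s)%R ->
    \forall n \near \oo, (a - s)%:E <= u n /\ u n <= (a + s)%:E) ->
  u @ \oo --> a%:E.
Proof.
move=> ua; apply/fine_cvgP; split.
  near=> n.
  have [ul ur] : (a - 1)%:E <= u n /\ u n <= (a + 1)%:E by near: n; exact: ua.
  by rewrite fin_numElt (lt_le_trans (ltNyr _) ul) (le_lt_trans ur (ltry _)).
apply/cvgrPdist_le => s s0; near=> n.
have : (a - s)%:E <= u n /\ u n <= (a + s)%:E by near: n; exact: ua.
move=> /=; case: (u n) => [r| |] [] /= //; rewrite !lee_fin => h1 h2.
by rewrite ler_norml; apply/andP; split; lra.
Unshelve. all: by end_near. Qed.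

(** If [a < h x], choose a real [b] strictly between. Semicontinuity gives [b < h] near [x], while
    [h (x_ n) < b] eventually; a cluster point forces these two sets to meet. *)
Lemma lsc_cluster_le {R : realType} {X : topologicalType} {A : set X}
    {h : X -> \bar R} {x_ : nat -> X} {a : R} {x : X} :
  lsc_on h A -> A x -> cluster (x_ @ \oo) x -> h (x_ n) @[n --> \oo] --> a%:E ->
  h x <= a%:E.
Proof.
move=> hlsc Ax clx hx; rewrite leNgt; apply/negP => ahx.
have [b ab bhx] : exists2 b : R, (a < b)%R & b%:E < h x.
  case: (h x) ahx => [r| |] //; last first.
    by move=> _; exists (a + 1)%R; rewrite ?ltry// ltrDl.
  rewrite lte_fin => ar; exists ((a + r) / 2)%R; rewrite ?lte_fin; lra.
have hxb : \forall n \near \oo, h (x_ n) < b%:E.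
  by apply: (hx [set y | y < b%:E]); apply: open_ereal_lt'; rewrite lte_fin.
have [y [/= yb]] := clx _ _ (hxb : (x_ @ \oo) [set y | h y < b%:E])
  (hlsc _ Ax _ bhx).
by move=> /(lt_trans yb); rewrite ltxx.
Qed.

(** By exactness [x0] also minimizes the penalty function on [A], and there the penalty term
    vanishes. *)
Lemma exact_parameter_optimal_le {R : realType} {X : Type} {M A : set X}
    {f phi : X -> \bar R} {l : R} {x0 : X} :
  (forall x, phi x = 0 <-> M x) -> exact_parameter f phi M A l ->
  globally_optimal f M A x0 ->
  forall x, A x -> f x0 <= penalty_fun f phi l x.
Proof.
move=> phi_eq0 [_ _ lP] x0opt x Ax; have [[Mx0 _] _] := x0opt.
have [_ /(_ _ Ax)] := (lP x0).2 x0opt.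
by rewrite {1}/penalty_fun ((phi_eq0 x0).2 Mx0) mule0 adde0.
Qed.

Lemma optimal_valueE {R : realType} {X : Type} {M A : set X}
    {f : X -> \bar R} {x0 : X} :
  globally_optimal f M A x0 -> optimal_value f M A = f x0.
Proof.
move=> [Dx0 x0min]; apply/eqP; rewrite eq_le; apply/andP; split.
  by apply: ereal_inf_lbound; exists x0.
by apply: le_ereal_inf_tmp => _ [y Dy <-]; exact: x0min.
Qed.

(** The estimate at a single point, carried from [\bar R] to [R]. Once all values are finite,
    [lambda * c <= lambda * (b + s)] replaces the approximate penalty [b] by the exact one [c], and
    the difference of the two hypotheses on [fs] bounds [(lambda - l) * c]. *)
Lemma penalty_gap {R : realType} {fx phix Phix : \bar R} {fs l lambda s e : R} :
  (0 <= l)%R -> (l < lambda)%R -> -oo < fx -> 0 <= phix -> 0 <= Phix ->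
  phix <= Phix + s%:E -> fs%:E <= fx + l%:E * phix ->
  fx + lambda%:E * Phix <= (fs + e)%:E ->
  exists a c : R, [/\ fx = a%:E, phix = c%:E, (0 <= c)%R,
    ((lambda - l) * c <= lambda * s + e)%R &
    (fs - l * c <= a <= fs + e)%R].
Proof.
move=> l0 ll fxNy phi0 Phi0 phiPhi lo up.
have lambda0 : (0 < lambda)%R by exact: le_lt_trans ll.
case: fx fxNy lo up => [a| |] // _ lo up; last first.
  suff : +oo + lambda%:E * Phix = +oo by move=> E; rewrite E in up.
  by rewrite addye// gt_eqF// (lt_le_trans (ltNyr 0))// mule_ge0// lee_fin ltW.
(* Strict positivity of [lambda] matters: as [0 * +oo = 0], only then does an infinite [Phix]
   contradict [up]. *)
case: Phix Phi0 phiPhi up => [b| |] // b0 phiPhi up; last first.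
  by rewrite gt0_muley ?lte_fin// in up.
case: phix phi0 phiPhi lo => [c| |] // c0 phiPhi lo.
exists a, c; move: b0 c0 phiPhi up lo.
rewrite -!EFinM -!EFinD !lee_fin => b0 c0 phiPhi up lo.
have H : (lambda * c <= lambda * (b + s))%R by rewrite ler_pM2l.
have H' : (0 <= lambda * b)%R by rewrite mulr_ge0// ltW.
by split=> //; [lra | apply/andP; split; lra].
Qed.

Theorem proposition5p2 (R : realType) (X P : metricType R) (M A : set X)
    (f phi : X -> \bar R) (p0 : P) (Phi : X -> P -> \bar R)
    (lambda : R) (p_ : nat -> P) (x_ : nat -> X) (eps_ : nat -> R)
    (M_neq0 : M !=set0) (A_neq0 : A !=set0)
    (f_gtNy : forall x, -oo < f x)
    (f_min : exists x, globally_optimal f M A x)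
    (f_min_fin : optimal_value f M A \is a fin_num)
    (phi_ge0 : forall x, 0 <= phi x)
    (phi_eq0 : forall x, phi x = 0 <-> M x)
    (g_exact : exact_penalty f phi M A)
    (Phi_approx : penalty_approximation A phi p0 Phi)
    (p_cvg : p_ @ \oo --> p0)
    (x_in : forall n, A (x_ n))
    (lambda_gt : (least_exact_parameter f phi M A < lambda)%R)
    (eps_gt0 : forall n, (0 < eps_ n)%R)
    (eps_decr : nonincreasing_seq eps_)
    (eps_cvg : eps_ @ \oo --> (0 : R)%R)
    (x_min : forall n,
      penalty_fun f (Phi ^~ (p_ n)) lambda (x_ n) <=
        ereal_inf [set penalty_fun f (Phi ^~ (p_ n)) lambda x | x in A]
        + (eps_ n)%:E) :
  [/\ phi (x_ n) @[n --> \oo] --> 0,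
      f (x_ n) @[n --> \oo] --> optimal_value f M A &
      lsc_on f A -> lsc_on phi A -> closed A ->
        forall xstar : X, cluster (x_ @ \oo) xstar ->
          globally_optimal f M A xstar].
Proof.
have [x0 x0opt] := f_min; have [[Mx0 Ax0] _] := x0opt.
have [Phi_ge0 _ Phi_cvg] := Phi_approx.
have [l lE ll] : exists2 l, exact_parameter f phi M A l & (l < lambda)%R.
  exact: inf_lt g_exact lambda_gt.
have [l0 _ _] := lE.
have fsE := optimal_valueE x0opt.
have [fs fs_def] : exists fs : R, f x0 = fs%:E.
  by exists (fine (f x0)); rewrite fineK// -fsE.
have lo := exact_parameter_optimal_le phi_eq0 lE x0opt.
have lambda0 : (0 < lambda)%R by exact: le_lt_trans ll.
have gap (d : R) : (0 < d)%R -> \forall n \near \oo,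
    exists a c : R, [/\ f (x_ n) = a%:E, phi (x_ n) = c%:E, (0 <= c)%R,
      ((lambda - l) * c <= d)%R & (fs - l * c <= a <= fs + d)%R].
  (* The approximation error [lambda * s = d / 4] is paid twice, at [x0] in [up] and at [x_ n] in
     [penalty_gap]; [eps_ n < d / 2] takes the rest of [d]. *)
  move=> d0; pose s := (d / 4 / lambda)%R.
  have s0 : (0 < s)%R by rewrite !divr_gt0.
  have lambdas : (lambda * s = d / 4)%R.
    by rewrite /s mulrC divfK// gt_eqF.
  near=> n.
  have Phin : forall x, A x -> Phi x (p_ n) <= phi x + s%:E /\
      phi x <= Phi x (p_ n) + s%:E.
    by near: n; exact: (p_cvg _ (Phi_cvg _ s0)).
  have epsn : (eps_ n < d / 2)%R.
    by near: n; apply: cvgr_lt eps_cvg _ _; rewrite divr_gt0.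
  have up : f (x_ n) + lambda%:E * Phi (x_ n) (p_ n) <=
      (fs + (lambda * s + eps_ n))%:E.
    apply: (le_trans (x_min n)); rewrite addrA EFinD leeD2r//.
    apply: (@le_trans _ _ (penalty_fun f (Phi ^~ (p_ n)) lambda x0)).
      by apply: ereal_inf_lbound; exists x0.
    rewrite /penalty_fun fs_def EFinD leeD2l// EFinM lee_pmul2l ?lte_fin//.
    by have [] := Phin _ Ax0; rewrite ((phi_eq0 x0).2 Mx0) add0e.
  have lon : fs%:E <= f (x_ n) + l%:E * phi (x_ n).
    by rewrite -fs_def; exact: lo.
  have [a [c [fa phic c0 kc /andP[fsa afs]]]] :=
    penalty_gap l0 ll (f_gtNy _) (phi_ge0 _) (Phi_ge0 _ _)
      (Phin _ (x_in n)).2 lon up.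
  by exists a, c; split=> //; [lra | apply/andP; split; lra].
have bound (s : R) : (0 < s)%R -> \forall n \near \oo,
    [/\ 0 <= phi (x_ n), phi (x_ n) <= s%:E, (fs - s)%:E <= f (x_ n) &
      f (x_ n) <= (fs + s)%:E].
  move=> s0; pose k := (lambda - l)%R; have k0 : (0 < k)%R by rewrite subr_gt0.
  (* Using [gap] with [d = k * t] gives [c <= t], so [f (x_ n)] lies between [fs - l * t] and
     [fs + k * t]. This [t] makes [t], [l * t] and [k * t] add up to [s], so each is at most [s]. *)
  pose t := (s / (1 + l + k))%R.
  have t0 : (0 < t)%R by rewrite divr_gt0// addr_gt0// ltr_wpDr.
  have tE : (t + l * t + k * t = s)%R.
    by rewrite -{1}[t]mul1r -!mulrDl mulrC divfK// gt_eqF// addr_gt0// ltr_wpDr.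
  have lt0 : (0 <= l * t)%R by rewrite mulr_ge0// ltW.
  have kt0 : (0 < k * t)%R by rewrite mulr_gt0.
  apply: filterS (gap _ kt0) => n [a [c [-> -> c0]]].
  rewrite ler_pM2l// => ct /andP[fsa afs].
  have lc : (l * c <= l * t)%R by rewrite ler_wpM2l.
  by rewrite !lee_fin; split=> //; lra.
have phi_cvg : phi (x_ n) @[n --> \oo] --> 0.
  apply: cvg_EFin_le_dist => s s0; apply: filterS (bound _ s0) => n [h1 h2 _ _].
  by rewrite sub0r add0r; split=> //; apply: le_trans h1; rewrite lee_fin; lra.
have f_cvg : f (x_ n) @[n --> \oo] --> fs%:E.
  by apply: cvg_EFin_le_dist => s s0; apply: filterS (bound _ s0) => n [].
split=> //; first by rewrite fsE fs_def.
move=> flsc philsc Acl xs xs_cl.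
have Axs : A xs.
  (* [A] belongs to the filter [x_ @ \oo], so every neighbourhood of [xs] meets [A]. *)
  apply: Acl => B Bxs; apply: xs_cl Bxs.
  by exists 0%N => // n _; exact: x_in.
have fxs := lsc_cluster_le flsc Axs xs_cl f_cvg.
have phixs := lsc_cluster_le philsc Axs xs_cl phi_cvg.
split.
  by split=> //; apply/phi_eq0/eqP; rewrite eq_le phixs phi_ge0.
by move=> y Dy; apply: le_trans fxs _; rewrite -fs_def; exact: x0opt.2.
Unshelve. all: by end_near. Qed.
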